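(* Let $A\in\mathbb{R}^{m\times n}$ have full row rank, $b\in\mathbb{R}^m$, and let $f:\mathbb{R}^n\to\mathbb{R}$ be continuously differentiable. Let $P=I-A^T(AA^T)^{-1}A$. Let $x_0$ be the feasible initial point (so $Ax_0=b$) and let $S_f=\{x\in\mathbb{R}^n:\ f(x)\le f(x_0),\ Ax=b\}$. Assume that the gradient satisfies, for some constant $L_c>0$, $$\|\nabla f(x)-\nabla f(y)\|\le L_c\|x-y\|\quad\text{for all }x,y\in S_f,$$ and that $f$ is bounded below on $S_f$. Let $\{x_k\}_{k\ge 0}$ be an infinite sequence generated from $x_0$ by the Eptctr algorithm (described in the context) with termination parameter $\epsilon=0$, and write $g_k=\nabla f(x_k)$. Then $$\liminf_{k\to\infty}\|Pg_k\|=0.$$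
   Context: $\|\cdot\|$ is the Euclidean norm. The problem is $\min_{x\in\mathbb{R}^n} f(x)$ subject to $Ax=b$. The Eptctr algorithm. Constants: $\eta_a=10^{-6}$, $\eta_1=0.25$, $\gamma_1=2$, $\eta_2=0.75$, $\gamma_2=0.5$, $\theta=10^{-6}$, and a termination parameter $\epsilon\ge 0$. A user-supplied initial point is first replaced by its Euclidean projection onto $\{x: Ax=b\}$; the result is called $x_0$. Set $\Delta t_0=10^{-2}$, and initialize a stored pair of vectors $\sigma_{-1}=0$, $y_{-1}=0$ in $\mathbb{R}^n$. Write $g_k=\nabla f(x_k)$ and $p_{g_k}=Pg_k$. For $k=0,1,2,\dots$: 1. If $\|p_{g_k}\|\le\epsilon$, stop. 2. Let $$H_k=I-\frac{y_{k-1}\sigma_{k-1}^T+\sigma_{k-1}y_{k-1}^T}{y_{k-1}^T\sigma_{k-1}}+2\,\frac{y_{k-1}^Ty_{k-1}}{(y_{k-1}^T\sigma_{k-1})^2}\,\sigma_{k-1}\sigma_{k-1}^T\quad\text{if } |\sigma_{k-1}^Ty_{k-1}|>\theta\|\sigma_{k-1}\|^2,$$ and $H_k=I$ otherwise. Compute the trial step $s_k=-\frac{\Delta t_k}{1+\Delta t_k}H_k p_{g_k}$. 3. Let $m_k(0)=0$, $m_k(s_k)=\frac{1+0.5\Delta t_k}{1+\Delta t_k}\,g_k^Ts_k$, and $$\rho_k=\frac{f(x_k)-f(x_k+s_k)}{m_k(0)-m_k(s_k)}.$$ 4. If $\rho_k\le\eta_a$ (step rejected), set $x_{k+1}=x_k$,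 $\sigma_k=\sigma_{k-1}$, $y_k=y_{k-1}$. Otherwise (step accepted), set $x_{k+1}=x_k+s_k$, $\sigma_k=x_{k+1}-x_k$, $y_k=P\nabla f(x_{k+1})-P\nabla f(x_k)$. 5. Set $\Delta t_{k+1}=\gamma_1\Delta t_k$ if $|1-\rho_k|\le\eta_1$; $\Delta t_{k+1}=\Delta t_k$ if $\eta_1<|1-\rho_k|<\eta_2$; $\Delta t_{k+1}=\gamma_2\Delta t_k$ if $|1-\rho_k|\ge\eta_2$. *)

(* Defs.v *)
From mathcomp Require Import all_boot all_order all_algebra.
From mathcomp Require Import all_classical all_reals all_analysis.

Set Implicit Arguments.
Unset Strict Implicit.
Unset Printing Implicit Defensive.

Import Order.TTheory GRing.Theory Num.Theory.
Import numFieldNormedType.Exports.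

Local Open Scope classical_set_scope.
Local Open Scope ring_scope.

Section Euclidean.
Context {R : realType} {n : nat}.
Implicit Types u v x : 'cV[R]_n.

Definition dot u v : R := (u^T *m v) 0 0.

(* The library norm [`|u|] on matrices is the sup norm, hence this one. *)
Definition enorm u : R := Num.sqrt (dot u u).

Definition grad (f : 'cV[R]_n -> R) x : 'cV[R]_n :=
  \col_(i < n) 'D_(delta_mx i 0) f x.

(* Continuity here refers to the sup norm, which induces the Euclidean
   topology. *)
Definition continuously_differentiable (f : 'cV[R]_n -> R) : Prop :=
  (forall x, differentiable f x) /\ continuous (grad f).

Definition is_euclidean_projection (C : set 'cV[R]_n) (z x : 'cV[R]_n) : Prop :=
  C x /\ forall w, C w -> enorm (z - x) <= enorm (z - w).

End Euclidean.

Section Eptctr.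
Context {R : realType} {m n : nat}.
Variables (A : 'M[R]_(m, n)) (b : 'cV[R]_m) (f : 'cV[R]_n -> R).
Implicit Types (x y g s sigma : 'cV[R]_n) (dt rho : R).

Definition feasible : set 'cV[R]_n := [set x | A *m x = b].

Definition level_set x0 : set 'cV[R]_n := [set x | f x <= f x0] `&` feasible.

(* [invmx] is the true inverse because [A *m A^T] is invertible when [A] has
   full row rank. *)
Definition kernel_proj_mx : 'M[R]_n := 1%:M - A^T *m invmx (A *m A^T) *m A.

Definition proj_grad x : 'cV[R]_n := kernel_proj_mx *m grad f x.

Definition eta_a : R := 10 ^- 6.
Definition eta1 : R := 1 / 4.
Definition gamma1 : R := 2.
Definition eta2 : R := 3 / 4.
Definition gamma2 : R := 1 / 2.
Definition theta : R := 10 ^- 6.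
Definition dt_init : R := 10 ^- 2.

(* At iteration k, [sigma_of] and [y_of] hold the stored pair
   sigma_{k-1}, y_{k-1}. *)
Record state := State {
  x_of : 'cV[R]_n;
  dt_of : R;
  sigma_of : 'cV[R]_n;
  y_of : 'cV[R]_n }.

Definition init_state x0 : state := State x0 dt_init 0 0.

Definition quasi_newton_mx sigma y : 'M[R]_n :=
  if theta * enorm sigma ^+ 2 < `|dot sigma y| then
    1%:M - (dot y sigma)^-1 *: (y *m sigma^T + sigma *m y^T)
    + (2 * (dot y y / dot y sigma ^+ 2)) *: (sigma *m sigma^T)
  else 1%:M.

Definition trial_step (st : state) : 'cV[R]_n :=
  - (dt_of st / (1 + dt_of st)) *:
    (quasi_newton_mx (sigma_of st) (y_of st) *m proj_grad (x_of st)).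

(* The value m_k(s_k) of the model at the trial step; m_k(0) = 0. *)
Definition model_at_step dt g s : R :=
  (1 + 1 / 2 * dt) / (1 + dt) * dot g s.

(* Division by 0 yields 0, but the denominator is nonzero when
   [dt_of st] is positive, the projected gradient is nonzero and the stored
   pair lies in the kernel of [A]. *)
Definition ratio (st : state) : R :=
  let x := x_of st in
  let s := trial_step st in
  (f x - f (x + s)) / (0 - model_at_step (dt_of st) (grad f x) s).

Definition update_dt dt rho : R :=
  if `|1 - rho| <= eta1 then gamma1 * dt
  else if `|1 - rho| < eta2 then dt
  else gamma2 * dt.

Definition eptctr_step (st : state) : state :=
  let x := x_of st in
  let rho := ratio st in
  let dt' := update_dt (dt_of st) rho in
  if rho <= eta_a then State x dt' (sigma_of st) (y_of st)
  else
    let x' := x + trial_step st in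
    State x' dt' (x' - x) (proj_grad x' - proj_grad x).

(* [x] is the infinite sequence produced from [x0]: the stopping test with
   tolerance [eps] fails at every iteration. *)
Definition eptctr_infinite_run (eps : R) x0 (x : nat -> 'cV[R]_n) : Prop :=
  forall k, x k = x_of (iter k eptctr_step (init_state x0))
            /\ ~ (enorm (proj_grad (x k)) <= eps).

End Eptctr.

(* Main.v *)
Require Import Defs.
From mathcomp Require Import all_boot all_order all_algebra.
From mathcomp Require Import all_classical all_reals all_analysis.
From mathcomp Require Import ring lra.
Import Order.TTheory GRing.Theory Num.Theory.
Import numFieldNormedType.Exports.
Local Open Scope classical_set_scope.
Local Open Scope ring_scope.

(** Throughout, let p be the projected gradient, H the quasi-Newton matrix, s the
trial step, a = dt / (1 + dt), and L a Lipschitz constant of the gradient on the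
level set S_f.

_The direction._  If H is not the identity, then with t = (sigma.p) / (y.sigma) one has
p.Hp = |p|^2 - 2 t (y.p) + 2 t^2 |y|^2, and p.Hp - |p|^2 / 2 is half of
|p - 2 t y|^2, so p.Hp >= |p|^2 / 2 ([quasi_newton_coercive]).  Since accepted
iterates lie in S_f, |y| <= L |sigma|; together with the safeguard
|sigma.y| > theta |sigma|^2 this gives |Hp| <= C |p| with C depending on L and
theta only ([enorm_quasi_newton]).  Both bounds are plain if H is the identity.  As
sigma, y and p lie in the kernel of A, so does s, and -g.s = a (p.Hp).

_The ratio is close to 1 for small dt._  The gradient is Lipschitz on S_f only, and
the segment from x to x + s could leave S_f.  It does not when dt is small
([descent_first_order]): the slope phi'(0) of phi(t) = f(x + t s) is negative, and
|phi'(t) - phi'(0)| < |phi'(0)| at every t in (0, 1] with phi(t) <= phi(0).  If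
phi(t) > phi(0) for some t, a minimizer of phi on [0, t] would be an interior critical
point c with phi(c) <= phi(0), which these two facts exclude.  The mean value theorem
then bounds the error of the first-order model, and |1 - rho| <= eta1 as soon as
dt <= [dt_threshold] ([ratio_near1]).  So dt stays above a positive constant
([dt_run_ge]).

_Conclusion._  Infinitely many steps are accepted, because every rejection halves dt
([eventually_accepted]).  An accepted step decreases f by at least
eta_a (a / 4) |p|^2 ([accepted_decrease]).  If |p| were bounded away from 0 along a
tail of the run, f would be unbounded below on S_f ([proj_grad_small]). *)

(** * The Euclidean inner product *)

Section EuclideanTheory.
Set Implicit Arguments.
Unset Strict Implicit.
Context {R : realType} {n : nat}.
Implicit Types u v w : 'cV[R]_n.

Lemma dotE u v : dot u v = \sum_i u i 0 * v i 0.
Proof. by rewrite /dot mxE; apply: eq_bigr => i _; rewrite mxE. Qed.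

Lemma dotC u v : dot u v = dot v u.
Proof. by rewrite !dotE; apply: eq_bigr => i _; rewrite mulrC. Qed.

Lemma dotDr u v w : dot u (v + w) = dot u v + dot u w.
Proof. by rewrite /dot mulmxDr mxE. Qed.

Lemma dotZr u a v : dot u (a *: v) = a * dot u v.
Proof. by rewrite /dot -scalemxAr mxE. Qed.

Lemma dotNr u v : dot u (- v) = - dot u v.
Proof. by rewrite -scaleN1r dotZr mulN1r. Qed.

Lemma dotDl u v w : dot (u + v) w = dot u w + dot v w.
Proof. by rewrite dotC dotDr !(dotC w). Qed.

Lemma dotZl a u v : dot (a *: u) v = a * dot u v.
Proof. by rewrite dotC dotZr dotC. Qed.

Lemma dotNl u v : dot (- u) v = - dot u v.
Proof. by rewrite dotC dotNr dotC. Qed.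

Lemma dot_mulmxr u (M : 'M[R]_n) v : dot u (M *m v) = dot (M^T *m u) v.
Proof. by rewrite /dot trmx_mul trmxK mulmxA. Qed.

Lemma dot_ge0 u : 0 <= dot u u.
Proof. by rewrite dotE; apply: sumr_ge0 => i _; rewrite -expr2 sqr_ge0. Qed.

Lemma enorm_ge0 u : 0 <= enorm u.
Proof. exact: sqrtr_ge0. Qed.

Lemma enorm_sqr u : enorm u ^+ 2 = dot u u.
Proof. by rewrite sqr_sqrtr ?dot_ge0. Qed.

Lemma enorm0 : enorm (0 : 'cV[R]_n) = 0.
Proof. by rewrite /enorm /dot mulmx0 mxE sqrtr0. Qed.

Lemma enormZ a u : enorm (a *: u) = `|a| * enorm u.
Proof.
by rewrite /enorm dotZl dotZr mulrA -expr2 sqrtrM ?sqr_ge0 // sqrtr_sqr.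
Qed.

Lemma enormN u : enorm (- u) = enorm u.
Proof. by rewrite -scaleN1r enormZ normrN1 mul1r. Qed.

Lemma cauchy_schwarz u v : `|dot u v| <= enorm u * enorm v.
Proof.
have sq : dot u v ^+ 2 <= dot u u * dot v v.
  have [v0|v0] := eqVneq (dot v v) 0.
    (* the quadratic a |-> |u + a v|^2 is affine when |v| = 0, and nonnegative *)
    suff -> : dot u v = 0 by rewrite expr0n /= mulr_ge0 ?dot_ge0.
    apply/eqP/negPn/negP => uv0.
    have := dot_ge0 (u + (- (dot u u + 1) / (2 * dot u v)) *: v).
    rewrite dotDl !dotDr !dotZl !dotZr v0 (dotC v u) !mulr0 addr0.
    set c := _ / _ * _.
    have -> : c = - (dot u u + 1) / 2 by rewrite /c; field.
    lra.
  have vgt0 : 0 < dot v v by rewrite lt_def v0 dot_ge0.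
  have := dot_ge0 (dot v v *: u - dot u v *: v).
  rewrite dotDl !dotDr !dotNl !dotNr !dotZl !dotZr (dotC v u).
  rewrite (_ : _ + _ = dot v v * (dot u u * dot v v - dot u v ^+ 2)); last by ring.
  by rewrite pmulr_rge0// subr_ge0.
rewrite -(@ler_pXn2r _ 2) ?nnegrE ?mulr_ge0 ?enorm_ge0 //.
by rewrite exprMn !enorm_sqr real_normK ?num_real.
Qed.

Lemma enormD u v : enorm (u + v) <= enorm u + enorm v.
Proof.
rewrite -(@ler_pXn2r _ 2) ?nnegrE ?addr_ge0 ?enorm_ge0 //.
rewrite sqrrD !enorm_sqr dotDl !dotDr (dotC v u).
have := le_trans (ler_norm _) (cauchy_schwarz u v); lra.
Qed.

End EuclideanTheory.

(** * Orthogonal projection onto the kernel of A *)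

Section KernelProjection.
Set Implicit Arguments.
Unset Strict Implicit.
Context {R : realType} {m n : nat} (A : 'M[R]_(m, n)).
Hypothesis fullA : row_free A.

Let P := kernel_proj_mx A.

Lemma mulmx_tr_eq0 (k l : nat) (M : 'M[R]_(k, l)) : M *m M^T = 0 -> M = 0.
Proof.
move=> M0; apply/matrixP => i j; rewrite mxE.
have /eqP := congr1 (fun N : 'M[R]_k => N i i) M0; rewrite !mxE.
rewrite psumr_eq0 => [/allP /(_ j)|a _]; last by rewrite mxE -expr2 sqr_ge0.
by rewrite mem_index_enum => /(_ isT) /=; rewrite mxE mulf_eq0 orbb => /eqP.
Qed.

(** If u (A A^T) = 0 then |u A|^2 = 0, hence u A = 0 and u = 0. *)
Lemma gram_unitmx : A *m A^T \in unitmx.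
Proof.
rewrite -row_free_unit -kermx_eq0.
set N := kermx _.
have NA0 : N *m A = 0.
  by apply: mulmx_tr_eq0; rewrite trmx_mul mulmxA -(mulmxA N) mulmx_ker mul0mx.
by rewrite -(mulmx_free_eq0 N fullA) NA0.
Qed.

Lemma kernel_proj_tr : P^T = P.
Proof.
rewrite /P /kernel_proj_mx linearB /= trmx1 !trmx_mul trmxK trmx_inv.
by rewrite trmx_mul trmxK mulmxA.
Qed.

Lemma mulmx_kernel_proj : A *m P = 0.
Proof.
by rewrite /P /kernel_proj_mx mulmxBr mulmx1 !mulmxA mulmxV ?gram_unitmx// mul1mx subrr.
Qed.

Lemma kernel_proj_id (v : 'cV[R]_n) : A *m v = 0 -> P *m v = v.
Proof.
by move=> Av; rewrite /P /kernel_proj_mx mulmxBl mul1mx -!mulmxA Av !mulmx0 subr0.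
Qed.

Lemma mulmx_kernel_proj_vec (v : 'cV[R]_n) : A *m (P *m v) = 0.
Proof. by rewrite mulmxA mulmx_kernel_proj mul0mx. Qed.

Lemma dot_kernel_proj (u v : 'cV[R]_n) : A *m v = 0 -> dot (P *m u) v = dot u v.
Proof. by move=> Av; rewrite -{1}kernel_proj_tr -dot_mulmxr kernel_proj_id. Qed.

Lemma enorm_kernel_proj (v : 'cV[R]_n) : enorm (P *m v) <= enorm v.
Proof.
rewrite /enorm ler_wsqrtr //.
have := dot_ge0 (v - P *m v).
have := dot_kernel_proj v (mulmx_kernel_proj_vec v).
rewrite dotDl !dotDr !dotNl !dotNr (dotC (P *m v) v); lra.
Qed.

End KernelProjection.

(** * The quasi-Newton matrix *)

Section QuasiNewton.
Set Implicit Arguments.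
Unset Strict Implicit.
Context {R : realType} {n : nat}.
Implicit Types (p y s : 'cV[R]_n) (L : R).

Lemma outer_mul y s p : y *m s^T *m p = dot s p *: y.
Proof. by rewrite -mulmxA [s^T *m p]mx11_scalar mul_mx_scalar. Qed.

Lemma quasi_newtonE s y p :
  theta * enorm s ^+ 2 < `|dot s y| ->
  quasi_newton_mx s y *m p =
    p - (dot s p / dot y s) *: y - (dot y p / dot y s) *: s
      + (2 * dot y y * dot s p / dot y s ^+ 2) *: s.
Proof.
move=> h; rewrite /quasi_newton_mx h !mulmxDl mulNmx mul1mx -!scalemxAl.
rewrite mulmxDl !outer_mul scalerDr !scalerA opprD !addrA.
congr (_ - _ - _ + _); congr (_ *: _); first by rewrite mulrC.
  by rewrite mulrC.
ring.
Qed.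

Lemma theta_gt0 : 0 < @theta R.
Proof. by rewrite /theta invr_gt0 exprn_gt0. Qed.

(** Coercivity needs neither a bound on y nor the positivity of the curvature
y.s. *)
Lemma quasi_newton_coercive s y p :
  dot p p / 2 <= dot p (quasi_newton_mx s y *m p).
Proof.
have [h|h] := ltP (theta * enorm s ^+ 2) (`|dot s y|); last first.
  rewrite /quasi_newton_mx ltNge h /= mul1mx; have := dot_ge0 p; lra.
rewrite quasi_newtonE // !dotDr !dotNr !dotZr.
set t := dot s p / dot y s.
(* the difference of the two sides is half of the square below *)
have := dot_ge0 (p - (2 * t) *: y).
rewrite dotDl !dotDr !dotNl !dotNr !dotZl !dotZr (dotC p s) (dotC y p).
have -> : dot p y / dot y s * dot s p = t * dot p y by rewrite /t; ring.
have -> : 2 * dot y y * dot s p / dot y s ^+ 2 * dot s p = 2 * t ^+ 2 * dot y y.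
  by rewrite /t exprMn exprVn; ring.
lra.
Qed.

(** A bound on the operator norm of the quasi-Newton matrix, valid for every stored
pair with |y| <= L |s|. *)
Definition quasi_newton_bound L : R :=
  1 + 2 * (L / theta) + 2 * (L / theta) ^+ 2.

Lemma quasi_newton_bound_ge1 L : 0 < L -> 1 <= quasi_newton_bound L.
Proof.
move=> L0; rewrite /quasi_newton_bound.
have r0 : 0 < L / theta by rewrite divr_gt0 ?theta_gt0.
have := sqr_ge0 (L / theta); lra.
Qed.

Lemma enorm_quasi_newton L s y p : 0 < L -> enorm y <= L * enorm s ->
  enorm (quasi_newton_mx s y *m p) <= quasi_newton_bound L * enorm p.
Proof.
move=> L0 ys.
have [h|h] := ltP (theta * enorm s ^+ 2) (`|dot s y|); last first.
  rewrite /quasi_newton_mx ltNge h /= mul1mx ler_peMl ?enorm_ge0//.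
  exact: quasi_newton_bound_ge1.
have th0 := theta_gt0.
have s0 : 0 < enorm s.
  rewrite lt_def enorm_ge0 andbT; apply/negP => /eqP s0.
  by move: h; have := cauchy_schwarz s y; rewrite s0 mul0r expr0n mulr0 ltNge => ->.
have d0 : 0 < `|dot y s|.
  by rewrite dotC (le_lt_trans _ h)// mulr_ge0 ?sqr_ge0 // ltW.
rewrite /quasi_newton_bound; move rE: (L / theta) => r.
have r0 : 0 < r by rewrite -rE divr_gt0.
have Lth : L = r * theta by rewrite -rE divfK ?gt_eqF.
have ysd : enorm y * enorm s <= r * `|dot y s|.
  apply: (@le_trans _ _ (L * enorm s * enorm s)).
    by rewrite ler_wpM2r ?enorm_ge0.
  have -> : L * enorm s * enorm s = r * (theta * enorm s ^+ 2).
    by rewrite {1}Lth; ring.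
  by rewrite ler_wpM2l ?(ltW r0) // dotC ltW.
have p0 := enorm_ge0 p.
have y0 := enorm_ge0 y.
have t1 : enorm ((dot s p / dot y s) *: y) <= r * enorm p.
  rewrite enormZ normrM normfV mulrAC ler_pdivrMr //.
  apply: (@le_trans _ _ (enorm s * enorm p * enorm y)).
    by rewrite ler_wpM2r ?cauchy_schwarz.
  rewrite (_ : _ * _ * _ = enorm y * enorm s * enorm p); last by ring.
  by rewrite [leRHS]mulrAC ler_wpM2r.
have t2 : enorm ((dot y p / dot y s) *: s) <= r * enorm p.
  rewrite enormZ normrM normfV mulrAC ler_pdivrMr //.
  apply: (@le_trans _ _ (enorm y * enorm p * enorm s)).
    by rewrite ler_wpM2r ?cauchy_schwarz ?enorm_ge0.
  by rewrite mulrAC [leRHS]mulrAC ler_wpM2r.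
have t3 : enorm ((2 * dot y y * dot s p / dot y s ^+ 2) *: s)
          <= 2 * r ^+ 2 * enorm p.
  rewrite enormZ normrM normfV normrX mulrAC ler_pdivrMr ?exprn_gt0 //.
  rewrite !normrM (ger0_norm (dot_ge0 y)) ger0_norm // -enorm_sqr.
  apply: (@le_trans _ _ (2 * enorm y ^+ 2 * (enorm s * enorm p) * enorm s)).
    rewrite ler_wpM2r ?enorm_ge0 // ler_wpM2l ?cauchy_schwarz //.
    by rewrite mulr_ge0 ?sqr_ge0.
  rewrite (_ : _ * _ * _ = 2 * enorm p * (enorm y * enorm s) ^+ 2); last by ring.
  rewrite [leRHS](_ : _ = 2 * enorm p * (r * `|dot y s|) ^+ 2); last by ring.
  rewrite ler_wpM2l ?mulr_ge0 // ler_pXn2r ?nnegrE ?mulr_ge0 ?enorm_ge0 ?(ltW r0) // ltW.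
rewrite quasi_newtonE //.
have := enormD (p - (dot s p / dot y s) *: y - (dot y p / dot y s) *: s)
  ((2 * dot y y * dot s p / dot y s ^+ 2) *: s).
have := enormD (p - (dot s p / dot y s) *: y) (- ((dot y p / dot y s) *: s)).
have := enormD p (- ((dot s p / dot y s) *: y)).
rewrite !enormN; lra.
Qed.

Lemma mulmx_quasi_newton (m : nat) (A : 'M[R]_(m, n)) s y p :
  A *m s = 0 -> A *m y = 0 -> A *m p = 0 -> A *m (quasi_newton_mx s y *m p) = 0.
Proof.
move=> As Ay Ap.
have [h|h] := ltP (theta * enorm s ^+ 2) (`|dot s y|); last first.
  by rewrite /quasi_newton_mx ltNge h /= mul1mx.
rewrite quasi_newtonE // !mulmxDr !mulmxN -!scalemxAr As Ay Ap.
by rewrite !scaler0 !oppr0 !addr0.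
Qed.

End QuasiNewton.

(** * Error of the first-order model along a line *)

Section FirstOrderModel.
Set Implicit Arguments.
Unset Strict Implicit.
Context {R : realType}.

(** The derivative of [phi] is controlled only at the points where [phi] does not exceed
its initial value; that these are all the points of [0, 1] is part of the proof. *)
Lemma descent_first_order (phi dphi : R -> R) (D : R) :
  (forall t : R, is_derive t 1 phi (dphi t)) -> dphi 0 < 0 -> D < - dphi 0 ->
  (forall t, 0 < t <= 1 -> phi t <= phi 0 -> `|dphi t - dphi 0| <= D) ->
  `|phi 1 - phi 0 - dphi 0| <= D.
Proof.
move=> dphiP dphi0 Dlt close.
have cphi (a c : R) : {within `[a, c], continuous phi}.
  by apply: derivable_within_continuous => t _; exact: ex_derive.
have decr t : 0 < t <= 1 -> phi t <= phi 0.
  move=> /andP[t0 t1]; rewrite leNgt; apply/negP => phit.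
  have [c cin cmin] := EVT_min (ltW t0) (cphi 0 t).
  have c0t : 0 <= c <= t by move: cin; rewrite in_itv.
  have phic0 : phi c <= phi 0 by apply: cmin; rewrite in_itv /= lexx ltW.
  have ct : c < t.
    case/andP: c0t => _; rewrite le_eqVlt => /orP[/eqP ct|//].
    by move: phit; rewrite -ct ltNge phic0.
  have [c0|cn0] := eqVneq c 0.
    (* a minimum at the left end contradicts the negative slope there *)
    have /cvgr_lt/(_ _ dphi0) : (fun h : R => h^-1 *: ((phi \o shift 0) (h *: 1) - phi 0)) @ 0^' --> dphi 0.
      have [dv <-] := dphiP 0; exact: dv.
    rewrite -nbhs_nearE => -[e /= e0 He].
    pose h := Num.min (e / 2) t.
    have h0 : 0 < h by rewrite lt_min t0 divr_gt0.
    have /= := He h; rewrite sub0r normrN gtr0_norm // => /(_ _ _) .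
    have he : h < e by rewrite gt_min; apply/orP; left; lra.
    move=> /(_ he (lt0r_neq0 h0)).
    rewrite [h *: 1]mulr1 addr0 -mulr_algl [_%:A]mulr1 pmulr_rlt0 ?invr_gt0 // subr_lt0.
    rewrite ltNge -{1}c0 cmin // in_itv /= (ltW h0) /=.
    by rewrite ge_min lexx orbT.
  (* otherwise c is an interior minimum, so the slope at c differs from the one at 0
     by more than D *)
  have cgt0 : 0 < c by rewrite lt_def cn0; case/andP: c0t.
  have cI : c \in `]0, t[ by rewrite in_itv /= cgt0.
  have minI u : u \in `]0, t[ -> phi c <= phi u.
    by rewrite in_itv /= => /andP[u0 ut]; apply: cmin; rewrite in_itv /= !ltW.
  have [_ dc] := derive1_at_min (ltW t0) (fun u _ => @ex_derive _ _ _ _ _ _ _ (dphiP u)) cI minI.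
  have dc0 : dphi c = 0 by rewrite -dc; have [_ ->] := dphiP c.
  have := close c; rewrite cgt0 (le_trans (ltW ct) t1) dc0 sub0r normrN ltr0_norm //.
  by move=> /(_ isT phic0); rewrite leNgt Dlt.
have [c cin ->] := MVT ltr01 (fun t _ => dphiP t) (cphi 0 1).
move: cin; rewrite in_itv /= => /andP[c0 c1].
by rewrite subr0 mulr1; apply: close; rewrite ?decr // c0 ltW.
Qed.

Context {n : nat}.
Implicit Types (x s : 'cV[R]_n) (f : 'cV[R]_n -> R).

Lemma dot_grad f x s : differentiable f x -> dot (grad f x) s = 'D_s f x.
Proof.
move=> df; rewrite deriveE // {2}(_ : s = \sum_i s i 0 *: delta_mx i 0).
  rewrite linear_sum dotE; apply: eq_bigr => i _.
  by rewrite linearZ /= mxE deriveE // mulrC.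
by rewrite {1}(matrix_sum_delta s); apply: eq_bigr => i _; rewrite big_ord1.
Qed.

Lemma is_derive_line f x s (t : R) : (forall u, differentiable f u) ->
  is_derive t 1 (fun u => f (x + u *: s)) (dot (grad f (x + t *: s)) s).
Proof.
move=> df.
have E : (fun h : R => h^-1 *: (((fun u => f (x + u *: s)) \o shift t) (h *: 1) - f (x + t *: s)))
  = (fun h : R => h^-1 *: ((f \o shift (x + t *: s)) (h *: s) - f (x + t *: s))).
  apply/funext => h /=; congr (_ *: (f _ - _)).
  by rewrite [h *: 1]mulr1 scalerDl addrCA.
apply: DeriveDef.
  by rewrite /derivable E; exact: diff_derivable.
by rewrite dot_grad // /derive E.
Qed.

Lemma descent_first_order_line f x s (D : R) : (forall u, differentiable f u) ->
  dot (grad f x) s < 0 -> D < - dot (grad f x) s ->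
  (forall t, 0 < t <= 1 -> f (x + t *: s) <= f x ->
    `|dot (grad f (x + t *: s) - grad f x) s| <= D) ->
  `|f (x + s) - f x - dot (grad f x) s| <= D.
Proof.
move=> df g0 Dlt close.
have := @descent_first_order (fun u => f (x + u *: s))
  (fun u => dot (grad f (x + u *: s)) s) D (fun t => is_derive_line x s t df).
rewrite scale0r scale1r addr0; apply => // t t01 ft.
by rewrite -dotNl -dotDl; exact: close.
Qed.

End FirstOrderModel.

(** * Analysis of the algorithm *)

Section Convergence.
Set Implicit Arguments.
Unset Strict Implicit.
Context {R : realType} {m n : nat}.
Variables (A : 'M[R]_(m, n)) (b : 'cV[R]_m) (f : 'cV[R]_n -> R) (x0 : 'cV[R]_n).
Variable L : R.
Hypothesis fullA : row_free A.
Hypothesis df : forall u, differentiable f u.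
Hypothesis L_gt0 : 0 < L.
Hypothesis lipschitz_grad : forall u v, level_set A b f x0 u -> level_set A b f x0 v ->
  enorm (grad f u - grad f v) <= L * enorm (u - v).

Let step := eptctr_step A f.
Let pgrad := proj_grad A f.

(** The invariant of the run: the iterate lies in the level set, dt is positive, and the
stored pair lies in the kernel of A and obeys the Lipschitz bound. *)
Definition admissible (st : state (R := R) (n := n)) : Prop :=
  [/\ level_set A b f x0 (x_of st), 0 < dt_of st,
      A *m sigma_of st = 0, A *m y_of st = 0 &
      enorm (y_of st) <= L * enorm (sigma_of st)].

Let C := quasi_newton_bound L.

(** A dt not exceeding this value yields a ratio within [eta1] of 1. *)
Definition dt_threshold : R := (4 * (1 + 4 * L * C ^+ 2))^-1.

Lemma mulmx_proj_grad u : A *m pgrad u = 0.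
Proof. exact: mulmx_kernel_proj_vec. Qed.

Lemma init_admissible : feasible A b x0 -> admissible (init_state x0).
Proof.
move=> Ax0; split; rewrite /= ?mulmx0 ?enorm0 ?mulr0 //; first by split => /=.
by rewrite /dt_init invr_gt0 exprn_gt0.
Qed.

Section OneStep.
Variable st : state (R := R) (n := n).
Hypothesis adm : admissible st.
Hypothesis p_gt0 : 0 < enorm (pgrad (x_of st)).

Let x := x_of st.
Let dt := dt_of st.
Let s := trial_step A f st.
Let p := pgrad x.
Let slope : R := - dot (grad f x) s.
Let rho := Defs.ratio A f st.

Let dt_gt0 : 0 < dt. Proof. by case: adm. Qed.
Let alpha_gt0 : 0 < dt / (1 + dt).
Proof. by rewrite divr_gt0 // addr_gt0. Qed.

Lemma mulmx_trial_step : A *m s = 0.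
Proof.
case: adm => _ _ As Ay _.
by rewrite /s /trial_step -scalemxAr mulmx_quasi_newton ?scaler0 // mulmx_proj_grad.
Qed.

Lemma level_set_trial (t : R) : f (x + t *: s) <= f x -> level_set A b f x0 (x + t *: s).
Proof.
case: adm => -[/= fx Ax] _ _ _ _ fxt; split; first exact: le_trans fx.
by rewrite /feasible /= mulmxDr -scalemxAr mulmx_trial_step scaler0 addr0.
Qed.

Lemma slopeE :
  slope = dt / (1 + dt) * dot p (quasi_newton_mx (sigma_of st) (y_of st) *m p).
Proof.
case: adm => _ _ As Ay _.
rewrite /slope /s /trial_step dotZr mulNr opprK -/dt -/x -/(pgrad x) -/p.
by rewrite [in RHS]dot_kernel_proj // mulmx_quasi_newton // mulmx_proj_grad.
Qed.

Lemma slope_ge : dt / (1 + dt) / 2 * enorm p ^+ 2 <= slope.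
Proof.
rewrite slopeE enorm_sqr -mulrA ler_wpM2l ?(ltW alpha_gt0) // mulrC.
exact: quasi_newton_coercive.
Qed.

Lemma slope_gt0 : 0 < slope.
Proof. by apply: lt_le_trans slope_ge; rewrite mulr_gt0 ?exprn_gt0 // divr_gt0. Qed.

Lemma enorm_trial_step : enorm s <= dt / (1 + dt) * (C * enorm p).
Proof.
case: adm => _ _ _ _ ys.
rewrite /s /trial_step enormZ normrN gtr0_norm // ler_wpM2l ?(ltW alpha_gt0) //.
exact: enorm_quasi_newton.
Qed.

(* the factor by which the model at the trial step differs from g.s *)
Let beta : R := (1 + 1 / 2 * dt) / (1 + dt).

Lemma predicted_reductionE : 0 - model_at_step dt (grad f x) s = beta * slope.
Proof. by rewrite /model_at_step -/beta /slope sub0r mulrN. Qed.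

Lemma beta_bounds : 1 - dt / 2 <= beta /\ 1 / 2 <= beta <= 1.
Proof.
have dt1 : 0 < 1 + dt by rewrite addr_gt0.
rewrite /beta; split; last (apply/andP; split).
- rewrite ler_pdivlMr //; have := sqr_ge0 dt; rewrite expr2; lra.
- rewrite ler_pdivlMr //; have := dt_gt0; lra.
- rewrite ler_pdivrMr //; have := dt_gt0; lra.
Qed.

Lemma predicted_reduction_gt0 : 0 < beta * slope.
Proof.
rewrite mulr_gt0 ?slope_gt0 //; case: beta_bounds => _ /andP[+ _].
by apply: lt_le_trans.
Qed.

(** The left-hand side bounds the variation of the directional derivative along the
trial step.  Here |s| <= a C |p| while the slope is at least a |p|^2 / 2. *)
Lemma curvature_error : L * enorm s ^+ 2 <= 2 * L * C ^+ 2 * dt * slope.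
Proof.
have C0 : 0 < C by rewrite (lt_le_trans ltr01) // quasi_newton_bound_ge1.
have -> : 2 * L * C ^+ 2 * dt * slope = L * (2 * C ^+ 2 * dt * slope) by ring.
rewrite ler_wpM2l ?(ltW L_gt0) //.
apply: (@le_trans _ _ ((dt / (1 + dt) * (C * enorm p)) ^+ 2)).
  rewrite ler_pXn2r ?nnegrE ?enorm_ge0 ?enorm_trial_step //.
  by rewrite mulr_ge0 ?(ltW alpha_gt0) // mulr_ge0 ?enorm_ge0 ?(ltW C0).
apply: (@le_trans _ _ (2 * C ^+ 2 * dt * (dt / (1 + dt) / 2 * enorm p ^+ 2))); last first.
  by rewrite ler_wpM2l ?slope_ge // !mulr_ge0 ?sqr_ge0 // ltW.
set a := dt / (1 + dt).
have a_le : a <= dt.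
  by rewrite /a ler_pdivrMr ?addr_gt0 // ler_peMr ?(ltW dt_gt0) // lerDl ltW.
have -> : (a * (C * enorm p)) ^+ 2 = (C * enorm p) ^+ 2 * a * a by ring.
have -> : 2 * C ^+ 2 * dt * (a / 2 * enorm p ^+ 2) = (C * enorm p) ^+ 2 * a * dt.
  by field.
by rewrite ler_wpM2l // mulr_ge0 ?sqr_ge0 // (ltW alpha_gt0).
Qed.

Lemma ratio_near1 : dt <= dt_threshold -> `|1 - rho| <= eta1.
Proof.
move=> dt_small.
have s_gt0 := slope_gt0.
have LC0 : 0 < L * C ^+ 2.
  by rewrite mulr_gt0 // exprn_gt0 // (lt_le_trans ltr01) // quasi_newton_bound_ge1.
pose kappa := 2 * L * C ^+ 2 * dt.
have kappaE : kappa = 2 * (L * C ^+ 2) * dt by rewrite /kappa; ring.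
have small : dt + 2 * kappa <= 1 / 4.
  move: dt_small; rewrite /dt_threshold -[_^-1]mul1r ler_pdivlMr; last first.
    by rewrite -mulrA; lra.
  rewrite kappaE; lra.
have err : `|f (x + s) - f x - dot (grad f x) s| <= kappa * slope.
  apply: descent_first_order_line => //.
  - by rewrite -oppr_gt0.
  - rewrite -/slope -[ltRHS]mul1r ltr_pM2r //; have := dt_gt0; lra.
  move=> t /andP[t0 t1] ft.
  apply: (le_trans (cauchy_schwarz _ _)).
  apply: le_trans curvature_error.
  rewrite expr2 mulrA ler_wpM2r ?enorm_ge0 //.
  have xS : level_set A b f x0 x by case: adm.
  apply: (le_trans (lipschitz_grad (level_set_trial ft) xS)).
  rewrite ler_wpM2l ?(ltW L_gt0) // addrAC subrr add0r enormZ gtr0_norm //.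
  by rewrite ler_piMl ?enorm_ge0.
have bs0 := predicted_reduction_gt0.
have [b1 /andP[b2 b3]] := beta_bounds.
rewrite /rho /Defs.ratio -/dt -/x -/s predicted_reductionE.
set E := f (x + s) - f x - dot (grad f x) s in err.
have -> : 1 - (f x - f (x + s)) / (beta * slope) = (E - (1 - beta) * slope) / (beta * slope).
  rewrite /E /slope; field.
  by move: bs0; rewrite /slope lt_def mulf_eq0 oppr_eq0 negb_or andbC => /andP[_ /andP[-> ->]].
rewrite normrM normfV (gtr0_norm bs0) ler_pdivrMr //.
apply: (le_trans (ler_normB _ _)).
rewrite (@ger0_norm _ ((1 - beta) * slope)); last first.
  by rewrite mulr_ge0 ?(ltW s_gt0) //; lra.
apply: (le_trans (lerD err (lexx _))).
rewrite -mulrDl mulrA ler_wpM2r ?(ltW s_gt0) // /eta1.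
lra.
Qed.

Lemma accepted_decrease : eta_a < rho ->
  f (x + s) <= f x - eta_a * (dt / (1 + dt) / 4 * enorm p ^+ 2).
Proof.
have bs0 := predicted_reduction_gt0.
rewrite /rho /Defs.ratio -/dt -/x -/s predicted_reductionE ltr_pdivlMr // => acc.
rewrite lerBrDr -lerBrDl; apply: le_trans (ltW acc).
rewrite ler_wpM2l ?invr_ge0 ?exprn_ge0 //.
have [_ /andP[b2 _]] := beta_bounds.
apply: (@le_trans _ _ (1 / 2 * slope)); last by rewrite ler_wpM2r // ltW ?slope_gt0.
have := slope_ge; lra.
Qed.

Lemma step_noninc : f (x_of (step st)) <= f x.
Proof.
rewrite /step /eptctr_step -/x -/s -/rho; case: ifPn => //=.
rewrite -ltNge => /accepted_decrease /le_trans; apply.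
rewrite gerBl mulr_ge0 ?invr_ge0 ?exprn_ge0 //.
by rewrite mulr_ge0 ?sqr_ge0 // divr_ge0 // ltW // alpha_gt0.
Qed.

Lemma step_dt_gt0 : 0 < dt_of (step st).
Proof.
have : 0 < update_dt dt rho.
  rewrite /update_dt; case: ifP => _; first by rewrite mulr_gt0 /gamma1.
  by case: ifP => _ //; rewrite mulr_gt0 // /gamma2 divr_gt0.
by rewrite /step /eptctr_step -/x -/s -/rho -/dt; case: ifP.
Qed.

Lemma step_admissible : admissible (step st).
Proof.
have := step_noninc; have := step_dt_gt0.
case: (adm) => xS _ As Ay ys.
rewrite /step /eptctr_step -/x -/s -/rho; case: ifP => _ dt0 fle; split => //=.
- by rewrite -[s]scale1r; apply: level_set_trial; rewrite scale1r.
- by rewrite addrAC subrr add0r mulmx_trial_step.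
- by rewrite mulmxBr !mulmx_proj_grad subr0.
- rewrite -mulmxBr; apply: (le_trans (enorm_kernel_proj fullA _)).
  apply: lipschitz_grad => //.
  by rewrite -[s]scale1r; apply: level_set_trial; rewrite scale1r.
Qed.

(** Below the threshold dt is doubled, above it dt is at worst halved. *)
Lemma step_dt_lower (dmin : R) : dmin <= dt -> dmin <= dt_threshold / 2 ->
  dmin <= dt_of (step st).
Proof.
move=> d1 d2.
have -> : dt_of (step st) = update_dt dt rho.
  by rewrite /step /eptctr_step -/x -/s -/rho -/dt; case: ifP.
rewrite /update_dt; have [ds|ds] := leP dt dt_threshold.
  rewrite ratio_near1 // /gamma1; have := dt_gt0; lra.
have := dt_gt0; case: ifP => _; first by rewrite /gamma1; lra.
by case: ifP => _; rewrite /gamma2; lra.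
Qed.

Lemma rejected_step : rho <= eta_a -> x_of (step st) = x /\ dt_of (step st) = dt / 2.
Proof.
move=> rej; rewrite /step /eptctr_step -/x -/s -/rho rej; split => //=.
have a0 : @eta_a R < 1 / 4.
  by rewrite /eta_a -natrX -div1r ltr_pM2l // ltf_pV2 ?posrE ?ltr_nat ?ltr0n.
rewrite /update_dt -/dt ger0_norm; last by lra.
rewrite ifF; last by apply/negbTE; rewrite -ltNge /eta1; lra.
rewrite ifF; last by apply/negbTE; rewrite -leNgt /eta2; lra.
by rewrite /gamma2; lra.
Qed.

End OneStep.

Let run k : state := iter k step (init_state x0).

Hypothesis feasible_x0 : feasible A b x0.
Hypothesis never_stops : forall k, 0 < enorm (pgrad (x_of (run k))).

Lemma run_admissible k : admissible (run k).
Proof.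
by elim: k => [|k IH]; [exact: init_admissible|exact: step_admissible].
Qed.

Lemma f_run_noninc k : f (x_of (run k.+1)) <= f (x_of (run k)).
Proof. exact: (step_noninc (run_admissible k) (never_stops k)). Qed.

(** A positive lower bound for dt along the whole run. *)
Definition dt_floor : R := Num.min dt_init (dt_threshold / 2).

Lemma dt_floor_gt0 : 0 < dt_floor.
Proof.
rewrite lt_min invr_gt0 exprn_gt0 // divr_gt0 // invr_gt0 mulr_gt0 //.
by rewrite ltr_wpDr // mulr_ge0 ?sqr_ge0 // mulr_ge0 // ltW.
Qed.

Lemma dt_run_ge k : dt_floor <= dt_of (run k).
Proof.
elim: k => [|k IH]; first by rewrite ge_min lexx.
apply: (step_dt_lower (run_admissible k) (never_stops k) IH).
by rewrite ge_min lexx orbT.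
Qed.

Lemma eventually_accepted k :
  exists2 j, (k <= j)%N & eta_a < Defs.ratio A f (run j).
Proof.
apply: contrapT => none.
have rej j : (k <= j)%N -> Defs.ratio A f (run j) <= eta_a.
  by move=> kj; rewrite leNgt; apply/negP => acc; apply: none; exists j.
have halved i : dt_of (run (k + i)) = dt_of (run k) / 2 ^+ i.
  elim: i => [|i IH]; first by rewrite addn0 expr0 divr1.
  rewrite addnS; have [_ ->] := rejected_step (rej _ (leq_addr i k)).
  by rewrite IH exprSr invfM mulrA.
have d0 := dt_floor_gt0.
have [i lt_i] : exists i, dt_of (run k) / dt_floor < 2 ^+ i.
  have q0 : 0 <= dt_of (run k) / dt_floor.
    by rewrite divr_ge0 // ltW //; case: (run_admissible k).
  exists (Num.bound (dt_of (run k) / dt_floor)).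
  apply: lt_trans (archi_boundP q0) _.
  by rewrite -natrX ltr_nat ltn_expl.
have := dt_run_ge (k + i); rewrite halved leNgt ltr_pdivrMr ?exprn_gt0 //.
by rewrite mulrC -ltr_pdivrMr // lt_i.
Qed.

Hypothesis f_bounded : has_lbound (f @` level_set A b f x0).

Lemma proj_grad_small (e : R) (K : nat) : 0 < e ->
  exists2 k, (K <= k)%N & enorm (pgrad (x_of (run k))) < e.
Proof.
move=> e0; apply: contrapT => none.
have large k : (K <= k)%N -> e <= enorm (pgrad (x_of (run k))).
  by move=> Kk; rewrite leNgt; apply/negP => lt_e; apply: none; exists k.
have d0 := dt_floor_gt0.
have mono i j : (i <= j)%N -> f (x_of (run j)) <= f (x_of (run i)).
  elim: j => [|j IH]; first by rewrite leqn0 => /eqP ->.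
  rewrite leq_eqVlt => /orP[/eqP -> //|]; rewrite ltnS => /IH.
  exact: le_trans (f_run_noninc j).
(* the least decrease of f at an accepted step once the projected gradients exceed e *)
pose c : R := eta_a * (dt_floor / (1 + dt_floor) / 4 * e ^+ 2).
have c0 : 0 < c.
  rewrite /c mulr_gt0 ?invr_gt0 ?exprn_gt0 // mulr_gt0 ?exprn_gt0 // divr_gt0 //.
  by rewrite divr_gt0 // addr_gt0.
have drop N : exists2 k, (K <= k)%N & f (x_of (run k)) <= f (x_of (run K)) - c *+ N.
  elim: N => [|N [k Kk IH]]; first by exists K; rewrite // mulr0n subr0.
  have [j kj acc] := eventually_accepted k.
  have Kj := leq_trans Kk kj.
  exists j.+1; first exact: leqW.
  have := accepted_decrease (run_admissible j) (never_stops j) acc.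
  have -> : x_of (run j) + trial_step A f (run j) = x_of (run j.+1).
    by rewrite /run iterS -/(run j) /step /eptctr_step leNgt acc.
  move=> /le_trans; apply.
  rewrite (mulrSr c) opprD addrA; apply: lerD; first exact: le_trans (mono _ _ kj) IH.
  rewrite lerN2 ler_wpM2l ?invr_ge0 ?exprn_ge0 //.
  have dj := dt_run_ge j.
  have dj0 := lt_le_trans d0 dj.
  apply: ler_pM; rewrite ?sqr_ge0 ?divr_ge0 ?addr_ge0 // ?(ltW d0) //.
    rewrite ler_wpM2r // ler_pdivrMr ?addr_gt0 // mulrAC ler_pdivlMr ?addr_gt0 //.
    lra.
  by rewrite ler_pXn2r ?nnegrE ?enorm_ge0 ?(ltW e0) ?large.
have [B Bf] := f_bounded.
have q0 : 0 <= (f (x_of (run K)) - B) / c.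
  rewrite divr_ge0 ?(ltW c0) // subr_ge0; apply: Bf.
  by exists (x_of (run K)) => //; case: (run_admissible K).
have := archi_boundP q0; set N := Num.bound _.
have [k _ fk] := drop N.
have Bk : B <= f (x_of (run k)).
  by apply: Bf; exists (x_of (run k)) => //; case: (run_admissible k).
rewrite ltr_pdivrMr // mulr_natl; lra.
Qed.

End Convergence.

Lemma limn_einf_eq0 (R : realType) (u : nat -> R) :
  (forall k, 0 <= u k) ->
  (forall e K, 0 < e -> exists2 k, (K <= k)%N & u k < e) ->
  limn_einf (fun k => (u k)%:E) = 0%E.
Proof.
move=> u0 small; rewrite limn_einf_lim.
suff -> : einfs (fun k => (u k)%:E) = cst 0%E by exact: lim_cst.
apply/funext => K; apply/eqP; rewrite eq_le; apply/andP; split.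
  apply/lee_addgt0Pr => e e0; rewrite add0e.
  have [k Kk uk] := small e K e0.
  apply: (@le_trans _ _ (u k)%:E); last by rewrite lee_fin ltW.
  by apply: ereal_inf_lbound; exists k.
by apply: le_ereal_inf_tmp => _ [k _ <-]; rewrite lee_fin.
Qed.

Theorem theorem1 (R : realType) (m n : nat) (A : 'M[R]_(m, n)) (b : 'cV[R]_m)
    (f : 'cV[R]_n -> R) (x_user x0 : 'cV[R]_n) (x : nat -> 'cV[R]_n) (Lc : R)
    (hA : row_free A)
    (hf : continuously_differentiable f)
    (hx0 : is_euclidean_projection (feasible A b) x_user x0)
    (hLc : 0 < Lc)
    (hlip : forall u v : 'cV[R]_n, level_set A b f x0 u -> level_set A b f x0 v ->
       enorm (grad f u - grad f v) <= Lc * enorm (u - v))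
    (hbound : has_lbound (f @` level_set A b f x0))
    (hrun : eptctr_infinite_run A f 0 x0 x) :
  limn_einf (fun k => (enorm (kernel_proj_mx A *m grad f (x k)))%:E) = 0%E.
Proof.
apply: limn_einf_eq0 => [k|e K e0]; first exact: enorm_ge0.
have run_pos k : 0 < enorm (proj_grad A f (x_of (iter k (eptctr_step A f) (init_state x0)))).
  by have [<- /negP] := hrun k; rewrite -ltNge.
have [k Kk small] := proj_grad_small hA (proj1 hf) hLc hlip (proj1 hx0) run_pos hbound K e0.
by exists k => //; have [-> _] := hrun k.
Qed.
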